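(* Let $S$ be a non special numerical semigroup and $T=\mathcal{A}(S)$. If there exists a gap $x\in\mathbb{N}\setminus S$ with $\operatorname{F}(S)-\operatorname{m}(S)+1\le x<\operatorname{F}(S)$, then $\operatorname{e}(T)\ge\operatorname{e}(S)$.
   Context: $\mathbb{N}=\{0,1,2,\ldots\}$. A numerical semigroup is a submonoid $S$ of $(\mathbb{N},+)$ with $\mathbb{N}\setminus S$ finite; $\operatorname{e}(S)$ is the number of minimal generators of $S$ (elements of $S\setminus\{0\}$ not expressible as a sum of two elements of $S\setminus\{0\}$). $\operatorname{H}(S)=\mathbb{N}\setminus S$; $\operatorname{F}(S)=\max\operatorname{H}(S)$; $\operatorname{m}(S)=\min(S\setminus\{0\})$. Special gaps: $\operatorname{SG}(S)=\{h\in\operatorname{H}(S)\mid 2h\in S \text{ and } h+s\in S \text{ for all } s\in S\setminus\{0\}\}$. $S$ is special if there is no $h\in\operatorname{SG}(S)\setminus\{\operatorname{F}(S)\}$ with $h>\operatorname{m}(S)$. For non special $S$, $\mathcal{A}(S)=(S\cup\{h\})\setminus\{\operatorname{m}(S)\}$ with $h=\max(\operatorname{SG}(S)\setminus\{\operatorname{F}(S)\})$. *)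

(* Defs.v *)
From mathcomp Require Import all_boot all_order finmap.
From mathcomp Require Import all_classical.

Set Implicit Arguments.
Unset Strict Implicit.
Unset Printing Implicit Defensive.

Local Open Scope classical_set_scope.
Local Open Scope nat_scope.

(* Both are 0 when no maximum (resp. minimum) exists. *)
Definition max_set (A : set nat) : nat := xget 0 (A `&` ubound A).
Definition min_set (A : set nat) : nat := xget 0 (A `&` lbound A).

Definition numerical_semigroup (S : set nat) : Prop :=
  [/\ S 0, (forall x y, S x -> S y -> S (x + y)) & finite_set (~` S)].

Definition gaps (S : set nat) : set nat := ~` S.

Definition frobenius (S : set nat) : nat := max_set (gaps S).

Definition multiplicity (S : set nat) : nat := min_set (S `\ 0).

Definition min_generators (S : set nat) : set nat :=
  [set x | (S `\ 0) x /\
           ~ (exists y z, [/\ (S `\ 0) y, (S `\ 0) z & x = y + z])].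

(* [fset_set] is only meaningful on finite sets; this is the case here by
   [finite_min_generators] below. *)
Definition embedding_dim (S : set nat) : nat :=
  #|` fset_set (min_generators S)|.

Definition special_gaps (S : set nat) : set nat :=
  [set h | [/\ gaps S h, S (2 * h) & forall s, (S `\ 0) s -> S (h + s)]].

Definition special (S : set nat) : Prop :=
  ~ (exists h, (special_gaps S `\ frobenius S) h /\ multiplicity S < h).

Definition transform (S : set nat) : set nat :=
  (S `|` [set max_set (special_gaps S `\ frobenius S)]) `\ multiplicity S.

Lemma finite_min_generators (S : set nat) :
  numerical_semigroup S -> finite_set (min_generators S).
Proof.
case=> S0 SD fG.
have [N hN] : exists N, forall x, N <= x -> S x.
  exists (\max_(i <- fset_set (~` S)) i).+1 => x ltx.
  apply: contrapT => Sx; have xi : x \in fset_set (~` S).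
    by rewrite in_fset_set // inE.
  have := @leq_bigmax_seq nat (enum_fset (fset_set (~` S))) xpredT id x xi isT.
  by rewrite leqNgt ltx.
apply: (@sub_finite_set _ _ `I_(N.+1 + N.+1)); last exact: finite_II.
move=> x [_ irr] /=; rewrite ltnNge; apply/negP => lex; apply: irr.
have leN : N.+1 <= x - N.+1 by rewrite leq_subRL // (leq_trans _ lex) ?leq_addr.
exists N.+1, (x - N.+1); split.
- by split; [apply: hN | ].
- split; first by apply: hN; apply: leq_trans leN.
  by move=> /= e; rewrite e in leN.
- by rewrite subnKC // (leq_trans _ lex) ?leq_addr.
Qed.

(* Main.v *)
Require Import Defs.
From mathcomp Require Import all_boot all_order finmap zify.
From mathcomp Require Import all_classical.

(** Put [m = m(S)], [F = F(S)], [h = max (SG(S) \ {F})].  Every gap [y] with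
    [max m (F - m) < y < F] is special, so the hypothesis forces [h > F - m] and
    no gap lies strictly between [h] and [F].  A minimal generator [g <> m] of
    [S] that decomposes in [T] has the form [h + z] with [z > m], and then
    [g - m] is a gap above [h], so [g = F + m].  Hence at most [m] and [F + m]
    are lost, while [h] and [2m] are always new. *)

Local Open Scope nat_scope.

Lemma max_setP (A : set nat) (N : nat) :
  (exists x, A x) -> ubound A N -> A (max_set A) /\ ubound A (max_set A).
Proof.
move=> [x Ax] AN; rewrite /max_set; case: xgetP => [y _ []//|none].
have exA : exists n, `[< A n >] by exists x; apply/asboolP.
have leN n : `[< A n >] -> n <= N by move=> /asboolP /AN.
have [n /asboolP An ubn] := ex_maxnP exA leN.
by case: (none n); split=> // k Ak; apply/ubn/asboolP.
Qed.

Lemma min_setP (A : set nat) :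
  (exists x, A x) -> A (min_set A) /\ lbound A (min_set A).
Proof.
move=> [x Ax]; rewrite /min_set; case: xgetP => [y _ []//|none].
have exA : exists n, `[< A n >] by exists x; apply/asboolP.
have [n /asboolP An lbn] := ex_minnP exA.
by case: (none n); split=> // k Ak; apply/lbn/asboolP.
Qed.

Lemma ubound_finite_set (A : set nat) : finite_set A -> exists N, ubound A N.
Proof.
move=> fA; exists (\max_(i <- fset_set A) i) => x Ax.
apply: (@leq_bigmax_seq nat (enum_fset (fset_set A)) xpredT id x) => //.
by rewrite in_fset_set // inE.
Qed.

Lemma leq_card_fset_set {I J : choiceType} (A : set I) (B : set J) (f : I -> J) :
  finite_set A -> finite_set B -> {in A &, injective f} ->
  (forall x, A x -> B (f x)) -> #|` fset_set A| <= #|` fset_set B|.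
Proof.
move=> fA fB fI fAB.
have <- : #|` [fset f x | x in fset_set A]%fset| = #|` fset_set A|.
  apply: card_in_imfset => x y /=; rewrite !in_fset_set //; exact: fI.
apply: fsubset_leq_card; apply/fsubsetP => _ /imfsetP [x /= xA ->].
by move: xA; rewrite !in_fset_set // !inE; apply: fAB.
Qed.

Lemma frobeniusP (S : set nat) : numerical_semigroup S ->
  (exists x, gaps S x) ->
  gaps S (frobenius S) /\ forall y, frobenius S < y -> S y.
Proof.
move=> [_ _ /ubound_finite_set [N SN]] exg.
have [gF ubF] := max_setP _ _ exg SN; split=> // y ltFy.
apply: contrapT => /ubF leyF; by have := leq_trans ltFy leyF; rewrite ltnn.
Qed.

Lemma multiplicityP (S : set nat) : numerical_semigroup S ->
  [/\ S (multiplicity S), 0 < multiplicity S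
    & forall s, S s -> 0 < s -> multiplicity S <= s].
Proof.
move=> [_ _ /ubound_finite_set [N SN]].
have [|[Sm m0] lbm] := min_setP (S `\ 0)%classic.
  (* [N] bounds the gaps, so [N.+1] is a nonzero element of [S]. *)
  by exists N.+1; split=> //; apply: contrapT => /SN /(leq_trans (ltnSn N)); rewrite ltnn.
split=> //; first by rewrite lt0n; apply/eqP.
by move=> s Ss s0; apply: lbm; split=> //= s_eq; rewrite s_eq in s0.
Qed.

(** A witness [k] of non-speciality makes the set nonempty, so its maximum is genuine rather than
    the default 0, and it inherits [multiplicity S < k]. *)
Lemma max_special_gapP (S : set nat) : numerical_semigroup S -> ~ special S ->
  let h := max_set (special_gaps S `\ frobenius S)%classic in
  [/\ special_gaps S h, h < frobenius S, multiplicity S < h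
    & forall y, special_gaps S y -> y < frobenius S -> y <= h].
Proof.
move=> hS /contrapT [k [[sgk kF] ltmk]] h.
have [gF SF] : gaps S (frobenius S) /\ forall y, frobenius S < y -> S y.
  by apply: frobeniusP => //; exists k; case: sgk.
have ub : ubound (special_gaps S `\ frobenius S)%classic (frobenius S).
  by move=> y [[gy _ _] _]; have [//|/SF /gy] := leqP y (frobenius S).
have [|[sgh hF] ubh] := max_setP _ _ _ ub; first by exists k.
split=> //.
- by rewrite ltn_neqAle; apply/andP; split; [apply/eqP | apply: ub].
- by apply: leq_trans ltmk _; apply: ubh.
- by move=> y sgy ltyF; apply: ubh; split=> //= yF; rewrite yF ltnn in ltyF.
Qed.

(** Adjoining a special gap keeps closure under addition. Removing [m] does too: all other nonzero
    elements, [h] included, exceed [m], so no two of them sum to [m]. *)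
Lemma numerical_semigroup_transform (S : set nat) :
  numerical_semigroup S -> ~ special S -> numerical_semigroup (transform S).
Proof.
move=> hS hns; have [sgh _ ltmh _] := max_special_gapP _ hS hns.
have [Sm m0 minm] := multiplicityP _ hS; rewrite /transform.
move: (max_set _) sgh ltmh => h [gh S2h Shs] ltmh.
move: (multiplicity S) Sm m0 minm ltmh => m Sm m0 minm ltmh.
case: hS => S0 SD fS.
have gtm s : S s -> s <> m -> s = 0 \/ m < s.
  move=> Ss sm; have [->|s0] := posnP s; [by left|right].
  have := minm s Ss s0; lia.
have Sh s : S s -> s = 0 \/ S (h + s).
  have [->|s0] := posnP s; [by left|move=> Ss; right; apply: Shs].
  by split=> //= e; rewrite e in s0.
split.
- by split; [left | move=> /= ?; lia].
- move=> x y [Tx xm] [Ty ym] /=.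
  have {}Tx : (S x /\ (x = 0 \/ m < x)) \/ x = h.
    by case: Tx => [Sx|->]; [left; split=> //; apply: gtm | right].
  have {}Ty : (S y /\ (y = 0 \/ m < y)) \/ y = h.
    by case: Ty => [Sy|->]; [left; split=> //; apply: gtm | right].
  split; last by move=> /= e; lia.
  case: Tx => [[Sx _]|->]; case: Ty => [[Sy _]|->].
  + by left; apply: SD.
  + by have [->|] := Sh x Sx; [right | rewrite addnC; left].
  + by have [->|] := Sh y Sy; [right; rewrite /= addn0 | left].
  + by left; rewrite addnn -mul2n.
- apply: (@sub_finite_set _ _ (~` S `|` [set m])%classic).
    move=> x /= nT; have [->|xm] := eqVneq x m; first by right.
    by left=> Sx; apply: nT; split; [left | apply/eqP].
  by rewrite finite_setU; split=> //; apply: finite_set1.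
Qed.

(* F(S) - m(S) + 1 <= x is written without (truncated) subtraction. *)
Theorem theorem4p9 (S T : set nat) (hS : numerical_semigroup S)
    (hns : ~ special S) (hT : T = transform S)
    (hx : exists x : nat,
        [/\ gaps S x, frobenius S + 1 <= x + multiplicity S
          & x < frobenius S]) :
  embedding_dim S <= embedding_dim T.
Proof.
have nsT : numerical_semigroup T.
  by rewrite hT; apply: numerical_semigroup_transform.
have fgS := finite_min_generators hS; have fgT := finite_min_generators nsT.
have [sgh lthF ltmh maxh] := max_special_gapP _ hS hns.
have [Sm m0 minm] := multiplicityP _ hS.
have [x [gx leFx ltxF]] := hx.
have [gF SF] := frobeniusP _ hS (ex_intro _ x gx).
rewrite /transform in hT.
set h := max_set _ in hT sgh lthF ltmh maxh.
set m := multiplicity S in hT ltmh Sm m0 minm leFx.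
set F := frobenius S in lthF maxh leFx ltxF gF SF.
clearbody h m F; have [gh S2h Shs] := sgh.
have [_ SD _] := hS.
(* Both [2 * y] and [y + s] are at least [y + m], hence beyond [F]. *)
have sg y : gaps S y -> F < y + m -> m < y -> y < F -> y <= h.
  move=> gy ltFy ltmy ltyF; apply: maxh => //; split=> //; first by apply: SF; lia.
  move=> s [Ss /eqP]; rewrite -lt0n => s0; apply: SF; have := minm s Ss s0; lia.
(* Either [x] exceeds [m] and is itself special, or [x <= m < h]. *)
have lexh : x <= h.
  have [ltmx|] := ltnP m x; last by lia.
  by apply: sg => //; lia.
(* As [y > h >= x], the bound [F < x + m] passes to [y]; if [y < F], then [sg] would give
   [y <= h]. *)
have gap_gt y : gaps S y -> h < y -> y = F.
  move=> gy lthy; have [ltyF|ltFy|//] := ltngtP y F; last by case: (gy (SF y ltFy)).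
  have := sg y gy; lia.
have Tgt y : (T `\ 0)%classic y -> y = h \/ S y /\ m < y.
  rewrite hT => -[[[Sy|->] /= ym] y0]; last by left.
  by right; split=> //; have := minm y Sy; lia.
have TS y : S y -> y <> m -> T y by rewrite hT; split; [left|].
have Th : T h by rewrite hT; split; [right | move=> /= ?; lia].
have genN y z : S y -> S z -> 0 < y -> 0 < z -> ~ min_generators S (y + z).
  move=> Sy Sz y0 z0 [_]; apply; exists y, z.
  by split=> //; split=> //= e; lia.
(* The two generators that may be lost go to the two new ones. Injectivity holds because [h] is a
   gap and [2 * m] decomposes, so neither is a minimal generator of [S], and the two differ. *)
pose f g := if g == m then h else if g == F + m then 2 * m else g.
apply: (leq_card_fset_set _ _ f) => //.
- move=> g k; rewrite !inE => gg gk; rewrite /f.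
  have neh y : min_generators S y -> y <> h by move=> [[Sy _] _] e; apply: gh; rewrite -e.
  have ne2 y : min_generators S y -> y <> 2 * m.
    by move=> gy e; apply: (genN m m) => //; rewrite addnn -mul2n -e.
  have h2m : h <> 2 * m.
    by move=> e; apply: gh; rewrite e mul2n -addnn; apply: SD.
  have := neh g gg; have := neh k gk; have := ne2 g gg; have := ne2 k gk.
  by do 4?case: eqP; lia.
- move=> g gg; rewrite /f; case: eqP => [_|gm]; last case: eqP => [_|gFm].
  (* In a decomposition of [h], a summand [h] would leave 0 for the other, and two summands from [S]
     would put [h] in [S]. *)
  + split; first by split=> //= ?; lia.
    move=> [y [z [/Tgt Ty /Tgt Tz e]]]; apply: gh; rewrite e.
    by case: Ty => [?|[Sy ?]]; case: Tz => [?|[Sz ?]]; [lia..|apply: SD].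
  (* All nonzero elements of [T] exceed [m], so two of them sum to more than [2 * m]. *)
  + split.
      split; last by move=> /= ?; lia.
      by apply: TS; [rewrite mul2n -addnn; apply: SD | lia].
    by move=> [y [z [/Tgt Ty /Tgt Tz e]]]; lia.
  + have [[Sg g0] irr] := gg.
    split; first by split=> //; apply: TS.
    (* The case [z = h] is included because [h > m]. Were [h + z - m] in [S], adding [m] to it would
       decompose [g] in [S]. *)
    have hz z : z = h \/ S z /\ m < z -> g <> h + z.
      move=> Tz e; have ltmz : m < z by lia.
      suff : h + z - m = F by lia.
      apply: gap_gt; last by lia.
      move=> Sgm; apply: (genN m (h + z - m)) => //; first by lia.
      by rewrite subnKC; [rewrite -e | lia].
    move=> [y [z [/Tgt Ty /Tgt Tz e]]].
    case: (Ty) => [yh|[Sy lty]]; first by apply: (hz z) => //; rewrite e yh.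
    case: (Tz) => [zh|[Sz ltz]]; first by apply: (hz y) => //; rewrite e zh addnC.
    by apply: (genN y z) => //; [lia | lia | rewrite -e].
Qed.
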